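(* Let $\mathbb H$ be the Heisenberg group, $N:\mathbb H\to[0,+\infty)$ a homogeneous norm and $B:=\{p\in\mathbb H:N(p)\le1\}$. Set $K:=\pi(B)\subset V_1$. Then $K$ is a compact, convex set with $K=-K$ and $K=\overline{\mathrm{int}(K)}$ (interior and closure in $V_1$), and there exists a function $f:K\to[0,+\infty)$, locally Lipschitz on $\mathrm{int}(K)$, such that $$B=\{v+zZ:\ v\in K,\ -f(-v)\le z\le f(v)\}.$$
   Context: The Heisenberg group $\mathbb H$ is the three-dimensional real vector space $\mathrm{span}\{X,Y,Z\}$ with the Lie bracket whose only nontrivial relation is $[X,Y]=Z$, equipped with the group operation $p\cdot q=p+q+\frac12[p,q]$; the neutral element is $0$ and $p^{-1}=-p$. Put $V_1=\mathrm{span}\{X,Y\}$, $V_2=\mathrm{span}\{Z\}$, and let $\pi:\mathbb H\to V_1$ be the linear projection along $V_2$. Dilations: $\delta_\lambda(xX+yY+zZ)=\lambda xX+\lambda yY+\lambda^2zZ$ for $\lambda>0$. A homogeneous norm is a function $N:\mathbb H\to[0,+\infty)$ such that for all $p,q\in\mathbb H$ and $\lambda>0$: $N(p)=0\iff p=0$; $N(pq)\le N(p)+N(q)$; $N(p^{-1})=N(p)$; $N(\delta_\lambda p)=\lambda N(p)$. *)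

(* Defs.v *)
From mathcomp Require Import all_boot all_order all_algebra.
From mathcomp Require Import all_classical all_reals all_analysis.
Import Order.TTheory GRing.Theory Num.Theory.
Import numFieldNormedType.Exports.
Set Implicit Arguments.
Unset Strict Implicit.
Unset Printing Implicit Defensive.
Local Open Scope ring_scope.

(* The pair (x, y) : horiz R stands for xX + yY, and (v, z) : heis R stands
   for v + zZ. The product types carry the vector space structure and the
   usual topologies of R^2 and R^3; R^o is R as a vector space over itself. *)
Notation horiz R := (R^o * R^o)%type.
Notation heis R := (R^o * R^o * R^o)%type.

Section Heisenberg.
Variable R : realType.
Implicit Types (p q : heis R) (l : R).

(* The bilinear alternating map with [X, Y] = Z, [X, Z] = [Y, Z] = 0. *)
Definition bracket p q : heis R :=
  (0, 0, p.1.1 * q.1.2 - p.1.2 * q.1.1).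

Definition hmul p q : heis R := p + q + 2^-1 *: bracket p q.

Definition hinv p : heis R := - p.

Definition dilation l p : heis R :=
  (l * p.1.1, l * p.1.2, l ^+ 2 * p.2).

Definition hproj p : horiz R := p.1.

Record homogeneous_norm (N : heis R -> R) : Prop := HomogeneousNorm {
  hnorm_ge0 : forall p, 0 <= N p;
  hnorm_eq0 : forall p, N p = 0 <-> p = 0;
  hnorm_mul : forall p q, N (hmul p q) <= N p + N q;
  hnorm_inv : forall p, N (hinv p) = N p;
  hnorm_dil : forall l p, 0 < l -> N (dilation l p) = l * N p
}.

End Heisenberg.

(* Main.v *)
(* If p, q are in B and 0 <= t <= 1, then so is the product of the dilations of
   p by 1 - t and of q by t. Its projection is the convex combination of those
   of p and q, so K is convex. For p, q in the same fiber {v + zZ} the bracket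
   vanishes and the height of the product is (1 - t)^2 z_p + t^2 z_q; iterating
   with p = q and t = 1/2 brings the height to 0, and taking then p = v shows
   that the fiber is an interval around 0. Its upper end f(v) satisfies
   f((1 - t) v + t w) >= (1 - t)^2 f(v) - O(t), hence the Lipschitz bound.
   The topological facts follow from
   N(x, y, z) <= C (|x| + |y| + |z - xy/2|^(1/2)), which makes N continuous, and
   from N([p, q]) <= 2 (N p + N q) with q = X, Y, which makes B bounded. *)
Require Import Defs.
From mathcomp Require Import all_boot all_order all_algebra.
From mathcomp Require Import all_classical all_reals all_analysis.
From mathcomp Require Import ring lra.
Import Order.TTheory GRing.Theory Num.Theory.
Import numFieldNormedType.Exports.
Local Open Scope classical_set_scope.
Local Open Scope ring_scope.

Section HomogeneousNorm.
Context {R : realType} {N : heis R -> R} (hN : homogeneous_norm N).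
Implicit Types (x y z t : R) (v w : horiz R) (p q : heis R).

(** * Group law and norm on horizontal and vertical elements *)

Definition symp v w : R := v.1 * w.2 - v.2 * w.1.

Lemma hmulE p q :
  hmul p q = (p.1 + q.1, p.2 + q.2 + 2^-1 * symp p.1 q.1).
Proof.
case: p q => [[x y] z] [[x' y'] z'].
by congr ((_, _), _); rewrite /= scaler0 addr0.
Qed.

Lemma hnorm0 : N 0 = 0.
Proof. by apply/(hnorm_eq0 hN). Qed.

(** Admitting t = 0 lets [ball_convex_comb] include both endpoints of [0, 1]. *)
Lemma hnorm_dilation t p : 0 <= t -> N (dilation t p) = t * N p.
Proof.
rewrite le_eqVlt => /predU1P[<-|]; last exact: (hnorm_dil hN).
rewrite mul0r -[RHS]hnorm0; congr N.
by rewrite /dilation expr0n !mul0r.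
Qed.

Lemma hnorm_opp v z : N (- v, - z) = N (v, z).
Proof. exact: (hnorm_inv hN (v, z)). Qed.

Lemma hnorm_horizontal t v : N (t *: v, 0) = `|t| * N (v, 0).
Proof.
have dilE s : dilation s (v, 0) = (s *: v, 0).
  by rewrite /dilation mulr0.
have [t0|t0] := leP 0 t; first by rewrite -dilE hnorm_dilation// ger0_norm.
rewrite -[RHS]hnorm_dilation ?normr_ge0// dilE ltr0_norm//.
by rewrite scaleNr -[LHS]hnorm_opp oppr0.
Qed.

Lemma hnorm_vertical z : N (0, z) = Num.sqrt `|z| * N (0, 1).
Proof.
rewrite -hnorm_dilation ?sqrtr_ge0// /dilation /= !mulr0 sqr_sqrtr//.
rewrite mulr1; have [z0|z0] := leP 0 z; first by rewrite ger0_norm.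
by rewrite ltr0_norm// -[LHS]hnorm_opp oppr0.
Qed.

Lemma hnorm_vertical_gt0 : 0 < N (0, 1).
Proof.
rewrite lt_def (hnorm_ge0 hN) andbT; apply/eqP => /(hnorm_eq0 hN)[] /eqP.
by rewrite oner_eq0.
Qed.

(** * Bounds for the norm and its continuity *)

Definition hnorm_bound x y z : R :=
  `|x| * N (1, 0, 0) + `|y| * N (0, 1, 0) +
  Num.sqrt `|z - 2^-1 * (x * y)| * N (0, 1).

(* (x, y, z) is the product of (x, 0, 0), (0, y, 0) and (0, 0, z - xy/2). *)
Lemma hnorm_le_bound p : N p <= hnorm_bound p.1.1 p.1.2 p.2.
Proof.
case: p => [[x y] z]; rewrite /hnorm_bound/=.
have xE : N (x, 0, 0) = `|x| * N (1, 0, 0).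
  rewrite -hnorm_horizontal.
  by congr (N (_, _, _)); rewrite /GRing.scale/= ?mulr0 ?mulr1.
have yE : N (0, y, 0) = `|y| * N (0, 1, 0).
  rewrite -hnorm_horizontal.
  by congr (N (_, _, _)); rewrite /GRing.scale/= ?mulr0 ?mulr1.
rewrite -xE -yE -hnorm_vertical.
rewrite [X in N X <= _](_ : _ =
  hmul (hmul (x, 0, 0) (0, y, 0)) (0, z - 2^-1 * (x * y))).
  apply: (le_trans (hnorm_mul hN _ _)); rewrite lerD2r.
  exact: (hnorm_mul hN).
rewrite !hmulE /symp/=; congr (_, _, _) => /=; ring.
Qed.

(** The group is nilpotent of step two, so the Lie bracket equals the group commutator of p and q, a
    product of four factors. *)
Lemma hnorm_bracket p q : N (bracket p q) <= 2 * (N p + N q).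
Proof.
have -> : bracket p q = hmul (hmul p q) (hmul (hinv p) (hinv q)).
  case: p q => [[x y] z] [[x' y'] z'].
  by rewrite !hmulE /symp /bracket /=; congr (_, _, _) => /=; field.
apply: (le_trans (hnorm_mul hN _ _)).
rewrite mulr_natl mulr2n; apply: lerD; first exact: (hnorm_mul hN).
by rewrite -(hnorm_inv hN p) -(hnorm_inv hN q) (hnorm_mul hN).
Qed.

(** Reverse triangle inequality for the left-invariant distance N(p^-1 q), which is symmetric
    because q^-1 p is the inverse of p^-1 q. *)
Lemma hnorm_dist p q : `|N p - N q| <= N (hmul (hinv p) q).
Proof.
have mulVK p' q' : hmul p' (hmul (hinv p') q') = q'.
  case: p' q' => [[x y] z] [[x' y'] z'].
  by rewrite !hmulE /symp /=; congr (_, _, _) => /=; field.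
have := hnorm_mul hN p (hmul (hinv p) q); rewrite mulVK => h1.
have := hnorm_mul hN q (hmul (hinv q) p); rewrite mulVK => h2.
have e : N (hmul (hinv q) p) = N (hmul (hinv p) q).
  rewrite -(hnorm_inv hN (hmul (hinv p) q)); congr N.
  move: p q {h1 h2} => [[x y] z] [[x' y'] z'].
  by rewrite /hinv !hmulE /symp /=; congr (_, _, _) => /=; field.
by rewrite ler_norml; move: h1 h2; rewrite e => h1 h2; apply/andP; split; lra.
Qed.

Lemma hnorm_bound_cvg {T : Type} {F : set_system T} {FF : Filter F}
    (f g h : T -> R) (a b c : R) :
  f t @[t --> F] --> a -> g t @[t --> F] --> b -> h t @[t --> F] --> c ->
  hnorm_bound (f t) (g t) (h t) @[t --> F] --> hnorm_bound a b c.
Proof.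
move=> fa gb hc.
have sc : Num.sqrt `|h t - 2^-1 * (f t * g t)| @[t --> F] -->
    Num.sqrt `|c - 2^-1 * (a * b)|.
  apply: continuous_cvg; first exact: sqrt_continuous.
  exact: (cvg_norm (cvgB hc (cvgMr (cvgM fa gb)))).
exact: (cvgD (cvgD (cvgMl (cvg_norm fa)) (cvgMl (cvg_norm gb))) (cvgMl sc)).
Qed.

Lemma hnorm_continuous : continuous N.
Proof.
move=> p.
have c1 : q.1.1 @[q --> p] --> (p.1.1 : R).
  by apply: (@cvg_comp _ _ _ fst fst); exact: cvg_fst.
have c2 : q.1.2 @[q --> p] --> (p.1.2 : R).
  by apply: (@cvg_comp _ _ _ fst snd); [exact: cvg_fst|exact: cvg_snd].
have c3 : q.2 @[q --> p] --> (p.2 : R) by exact: cvg_snd.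
(* [u q] is the bound of [hnorm_le_bound] at p^-1 q; it dominates |N p - N q| and tends to 0 as q
   tends to p. *)
pose u (q : heis R) := hnorm_bound (- p.1.1 + q.1.1) (- p.1.2 + q.1.2)
  (- p.2 + q.2 + 2^-1 * (- p.1.1 * q.1.2 - - p.1.2 * q.1.1)).
have u0 : u p = 0.
  rewrite /u /hnorm_bound !addNr !normr0 !mul0r !add0r.
  rewrite (_ : _ - _ = 0); last by ring.
  by rewrite normr0 sqrtr0 mul0r.
have cu : u q @[q --> p] --> (0 : R).
  rewrite -u0 /u.
  have cD (a : R) (f : heis R -> R) (l : R) :
    f q @[q --> p] --> l -> (a + f q) @[q --> p] --> a + l.
    by move=> fl; apply: cvgD => //; exact: cvg_cst.
  apply: hnorm_bound_cvg; [exact: cD|exact: cD|].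
  apply: cvgD; first exact: cD.
  by apply: cvgMr; apply: cvgB; apply: cvgMr.
apply: (squeeze_cvgr (f := fun q => N p - u q) (h := fun q => N p + u q)).
- apply: nearW => q; have := le_trans (hnorm_dist p q) (hnorm_le_bound _).
  rewrite hmulE /= -/(u q) ler_norml => /andP[? ?]; lra.
- by rewrite -[X in _ --> X]subr0; apply: cvgB => //; exact: cvg_cst.
- by rewrite -[X in _ --> X]addr0; apply: cvgD => //; exact: cvg_cst.
Qed.


(** * The unit ball: its fibers and its compactness *)

Let B : set (heis R) := [set p | N p <= 1].

Lemma ball_closed : closed B.
Proof.
apply: (@preimage_closed _ _ N [set r | r <= 1]) => // p _.
exact: hnorm_continuous.
Qed.

Lemma ball_opp {p} : B p -> B (- p).
Proof. by rewrite /B /= (hnorm_inv hN p). Qed.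

Lemma ball_convex_comb {v w y z t} : 0 <= t <= 1 -> B (v, y) -> B (w, z) ->
  B ((1 - t) *: v + t *: w,
     (1 - t) ^+ 2 * y + t ^+ 2 * z + 2^-1 * ((1 - t) * t * symp v w)).
Proof.
move=> /andP[t0 t1] Bv Bw; rewrite /B /=.
have s0 : 0 <= 1 - t by rewrite subr_ge0.
have : N (hmul (dilation (1 - t) (v, y)) (dilation t (w, z))) <= 1.
  apply: (le_trans (hnorm_mul hN _ _)).
  rewrite !hnorm_dilation// -[leRHS](subrK t); apply: lerD; exact: ler_piMr.
rewrite hmulE; apply: le_trans.
rewrite le_eqVlt; apply/orP; left; apply/eqP.
congr (N (_, _)); rewrite /symp /=; ring.
Qed.

Lemma ball_fiber {v y z t} : 0 <= t <= 1 -> B (v, y) -> B (v, z) ->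
  B (v, (1 - t) ^+ 2 * y + t ^+ 2 * z).
Proof.
move=> t01 By Bz; have := ball_convex_comb t01 By Bz.
by rewrite -scalerDl subrK scale1r /symp [v.2 * _]mulrC subrr !mulr0 addr0.
Qed.

Lemma ball_proj {v z} : B (v, z) -> B (v, 0).
Proof.
move=> Bvz.
have Bn n : B (v, (2^-1 : R) ^+ n * z).
  elim: n => [|n IHn]; first by rewrite mul1r.
  have h01 : 0 <= (2^-1 : R) <= 1 by apply/andP; split; lra.
  (* For t = 1/2 and equal heights the factor is 1/4 + 1/4, so the height is halved. *)
  have := ball_fiber h01 IHn IHn; congr (B (v, _)).
  by rewrite [in RHS]exprS; field.
have cz : (2^-1 : R) ^+ n * z @[n --> \oo] --> (0 : R).
  rewrite -(mul0r z); apply: cvgMl; apply: cvg_expr.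
  by rewrite ger0_norm ?invr_ge0// invf_lt1 ?ltr1n.
apply: (@closed_cvg _ _ \oo _ (fun n => (v, (2^-1 : R) ^+ n * z) : heis R) B
  ball_closed (nearW _ Bn)).
exact: (cvg_pair (cvg_cst v) cz).
Qed.

Lemma ball_shrink {v y z} : B (v, z) -> 0 <= y <= z -> B (v, y).
Proof.
move=> Bvz /andP[y0 yz].
have := y0; rewrite le_eqVlt => /predU1P[<-|{}y0]; first exact: ball_proj Bvz.
have z0 := lt_le_trans y0 yz.
have yz0 : 0 <= y / z by rewrite divr_ge0// ltW.
(* With this parameter, the points at heights 0 and z combine to height t^2 z = y. *)
have t01 : 0 <= Num.sqrt (y / z) <= 1.
  by rewrite sqrtr_ge0 -sqrtr1 ler_sqrt// ler_pdivrMr// mul1r.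
have := ball_fiber t01 (ball_proj Bvz) Bvz; congr (B (v, _)).
by rewrite mulr0 add0r sqr_sqrtr// divfK// gt_eqF.
Qed.

Lemma ball_bounded : exists2 M, 0 < M & forall p, B p ->
  [/\ `|p.1.1| <= M, `|p.1.2| <= M & `|p.2| <= M].
Proof.
have c0 := hnorm_vertical_gt0.
(* N(0, z) grows like the square root of |z|, so a bound on it bounds |z| quadratically. *)
have sqrt_le z (C : R) : Num.sqrt `|z| * N (0, 1) <= C ->
    `|z| <= (C / N (0, 1)) ^+ 2.
  rewrite -ler_pdivlMr// => h; rewrite -[`|z|]sqr_sqrtr//.
  by rewrite lerXn2r ?nnegrE ?sqrtr_ge0// (le_trans _ h) ?sqrtr_ge0.
pose a : R := (2 * (1 + N (0, 1, 0)) / N (0, 1)) ^+ 2.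
pose b : R := (2 * (1 + N (1, 0, 0)) / N (0, 1)) ^+ 2.
pose c : R := (2 / N (0, 1)) ^+ 2.
have [a0 b0 e0] : [/\ 0 <= a, 0 <= b & 0 <= c] by rewrite !sqr_ge0.
exists (1 + a + b + c) => [|[[x y] z] Bp]; first lra.
split => /=.
(* The bracket with Y isolates x; the next case isolates -y by the bracket with X. *)
- suff : `|x| <= a by lra.
  apply: sqrt_le; rewrite -hnorm_vertical.
  apply: (@le_trans _ _ (2 * (N (x, y, z) + N (0, 1, 0)))); last first.
    by rewrite ler_pM2l// lerD2r.
  apply: le_trans (hnorm_bracket _ _); rewrite /bracket /=.
  by rewrite !(mulr1, mulr0, subr0).
- suff : `|- y| <= b by rewrite normrN; lra.
  apply: sqrt_le; rewrite -hnorm_vertical.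
  apply: (@le_trans _ _ (2 * (N (x, y, z) + N (1, 0, 0)))); last first.
    by rewrite ler_pM2l// lerD2r.
  apply: le_trans (hnorm_bracket _ _); rewrite /bracket /=.
  by rewrite !(mulr1, mulr0, sub0r).
- suff : `|z| <= c by lra.
  apply: sqrt_le; rewrite -hnorm_vertical.
  (* Multiplying by the inverse of the projected point, which lies in B by [ball_proj], isolates the
     height. *)
  have -> : (0, z) = hmul (- (x, y), 0) (x, y, z) :> heis R.
    by rewrite hmulE /symp /=; congr (_, _, _) => /=; ring.
  apply: (le_trans (hnorm_mul hN _ _)).
  rewrite (_ : 2 = 1 + 1 :> R)//; apply: lerD => //.
  by rewrite -[X in N (_, X)]oppr0 hnorm_opp; exact: ball_proj Bp.
Qed.

Lemma ball_compact : compact B.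
Proof.
have [M M0 BM] := ball_bounded.
have cI := @segment_compact R (- M) M.
apply: (subclosed_compact ball_closed (compact_setX (compact_setX cI cI) cI)).
by move=> p /BM[? ? ?]; split; first split; rewrite /= in_itv /= -ler_norml.
Qed.

(** * The projection of the ball *)

Let K : set (horiz R) := @hproj R @` B.

(** By [ball_proj], the projection of B is also its slice at height 0. *)
Lemma shadowP v : K v <-> B (v, 0).
Proof.
by split=> [[[w z] Bp <-]|Bv]; [exact: ball_proj Bp|exists (v, 0)].
Qed.

Lemma shadow_comb {v w t} :
  0 <= t <= 1 -> K v -> K w -> K ((1 - t) *: v + t *: w).
Proof.
move=> t01 /shadowP Kv /shadowP Kw.
by eexists; first exact: ball_convex_comb t01 Kv Kw.
Qed.

Lemma shadow_opp {v} : K v -> K (- v).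
Proof. by move=> /shadowP/ball_opp Kv; apply/shadowP; rewrite -[0]oppr0. Qed.

Lemma shadow_compact : compact K.
Proof.
apply: continuous_compact; last exact: ball_compact.
by apply: continuous_subspaceT => p; exact: cvg_fst.
Qed.

Lemma shadow_nbhs0 : exists2 e : R, 0 < e & forall v, `|v| < e -> K v.
Proof.
have : \forall p \near (0 : heis R), N p < 1.
  by apply: (@cvgr_lt _ _ (nbhs (0 : heis R)) _ N _ (hnorm_continuous 0));
    rewrite hnorm0.
move=> /nbhs_normP[e /= e0 he]; exists e => // v ve; apply/shadowP/ltW/he => /=.
by rewrite sub0r normrN prod_normE /= normr0 gt_max ve.
Qed.

(** K contains a ball of radius e around 0; by convexity it contains the ball of radius t e around
    (1 - t) v. *)
Lemma shadow_interior v t : K v -> 0 < t <= 1 -> K° ((1 - t) *: v).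
Proof.
move=> Kv /andP[t0 t1]; have [e e0 eK] := shadow_nbhs0.
apply/(nbhs_normP (_ : horiz R)); exists (t * e) => /=; first exact: mulr_gt0.
move=> w /= hw.
rewrite (_ : w = (1 - t) *: v + t *: (t^-1 *: (w - (1 - t) *: v))); last first.
  by rewrite scalerA divff ?gt_eqF// scale1r addrC subrK.
apply: shadow_comb => //; first by rewrite ltW.
apply: eK; rewrite normrZ gtr0_norm ?invr_gt0// ltr_pdivrMl//.
by rewrite distrC.
Qed.

Lemma shadow_closure_interior : K = closure K°.
Proof.
apply/seteqP; split=> [v Kv|]; last first.
  have /closure_id {2}-> : closed K.
    by apply: compact_closed shadow_compact; exact: norm_hausdorff.
  by apply: closureS; exact: interior_subset.
move=> U /nbhs_normP[e /= e0 eU].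
(* This choice gives t |v| < e with t in (0, 1], also when v = 0. *)
pose t := e / (e + `|v|).
have d0 : 0 < e + `|v| by rewrite ltr_wpDr.
have t0 : 0 < t by rewrite divr_gt0.
exists ((1 - t) *: v); split.
  by apply: shadow_interior => //; rewrite t0 /t ler_pdivrMr// mul1r lerDl /=.
apply: eU => /=; rewrite scalerBl scale1r opprB addrCA subrr addr0.
rewrite normrZ gtr0_norm// /t mulrAC ltr_pdivrMr// mulrDr ltrDr.
exact: mulr_gt0.
Qed.

(** * The upper boundary function of the ball *)

Definition ceiling v : R := sup [set z | N (v, z) <= 1].

Lemma fiber_ubound v : has_ubound [set z | N (v, z) <= 1].
Proof.
have [M _ BM] := ball_bounded.
by exists M => z /= /BM[_ _]; exact/le_trans/ler_norm.
Qed.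

Lemma ceiling_ub v z : B (v, z) -> z <= ceiling v.
Proof. by move=> Bvz; apply: ub_le_sup => //; exact: fiber_ubound. Qed.

Lemma ceiling_ge0 {v} : K v -> 0 <= ceiling v.
Proof. by move=> /shadowP; exact: ceiling_ub. Qed.

(** The supremum is attained: over a point of K the fiber is nonempty, bounded above and closed. *)
Lemma ball_ceiling {v} : K v -> B (v, ceiling v).
Proof.
move=> /shadowP Bv0.
have hs : has_sup [set z | N (v, z) <= 1].
  by split; [exists 0|exact: fiber_ubound].
have : closed [set z | N (v, z) <= 1].
  apply: (@preimage_closed _ _ (fun z : R => (v, z) : heis R) B);
    last exact: ball_closed.
  by move=> z _; exact: (cvg_pair (cvg_cst v) cvg_id).
apply=> U /nbhs_normP[e /= e0 eU].
have [z Bz sz] := sup_adherent e0 hs.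
exists z; split=> //; apply: eU => /=.
by rewrite ger0_norm ?subr_ge0 ?ceiling_ub// ltrBlDl -ltrBlDr.
Qed.

(** Nonnegative heights come from shrinking the top point. Inversion swaps the fibers over v and -v,
    which gives the negative heights and the lower end. *)
Lemma ball_fiberE p :
  B p <-> K p.1 /\ - ceiling (- p.1) <= p.2 <= ceiling p.1.
Proof.
case: p => v z /=; split=> [Bvz|[Kv /andP[lez zle]]].
  split; first by exists (v, z).
  rewrite ceiling_ub// andbT lerNl; apply: ceiling_ub.
  exact: (@ball_opp (v, z)).
have [z0|z0] := leP 0 z.
  by apply: (ball_shrink (ball_ceiling Kv)); rewrite z0.
rewrite -[(v, z)]opprK; apply: ball_opp.
apply: (ball_shrink (ball_ceiling (shadow_opp Kv))).
by rewrite oppr_ge0 ltW//= lerNl.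
Qed.

(* The ray from b through a reaches, at distance r beyond a, a point w of K. So
   a = (1 - t) b + t w with t <= |b - a| / r, and ball_convex_comb applied to
   (b, ceiling b) and (w, 0) bounds the ceiling at a from below. *)
Lemma ceiling_lipschitz : exists2 C : R, 0 < C & forall r (a b : horiz R),
  0 < r -> (forall w, `|w - a| <= r -> K w) -> K b ->
  ceiling b - ceiling a <= C / r * `|b - a|.
Proof.
have [M M0 BM] := ball_bounded.
exists (2 * M + M ^+ 2) => [|r a b r0 ra Kb].
  by rewrite addr_gt0 ?exprn_gt0 ?mulr_gt0.
have [->|ab] := eqVneq a b; first by rewrite !subrr normr0 mulr0.
rewrite [`|b - a|]distrC; set d := `|a - b|.
have d0 : 0 < d by rewrite normr_gt0 subr_eq0.
have rd0 : 0 < r + d by rewrite addr_gt0.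
pose w := a + (r / d) *: (a - b); pose t := d / (r + d).
have Kw : K w.
  apply: ra; rewrite /w addrC addKr normrZ gtr0_norm ?divr_gt0//.
  by rewrite divfK// gt_eqF.
have aE : (1 - t) *: b + t *: w = a.
  have tE : t * (1 + r / d) = 1 by rewrite /t; field; rewrite !gt_eqF.
  rewrite scalerBl scale1r -addrA -scalerN -scalerDr.
  rewrite (_ : - b + w = (1 + r / d) *: (a - b)); last first.
    by rewrite scalerDl scale1r /w addrA [- b + a]addrC.
  by rewrite scalerA tE scale1r addrC subrK.
have t01 : 0 <= t <= 1.
  rewrite /t ler_pdivrMr// mul1r lerDr (ltW r0) andbT.
  by rewrite divr_ge0// ltW.
have /ceiling_ub := ball_convex_comb t01 (ball_ceiling Kb)
  ((shadowP w).1 Kw).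
rewrite aE mulr0 addr0 => lea.
have [b1 b2 fb] := BM _ (ball_ceiling Kb).
have [w1 w2 _] := BM _ ((shadowP w).1 Kw).
have fb0 := ceiling_ge0 Kb.
have tr : t <= d / r.
  by rewrite /t ler_pM2l// lef_pV2 ?posrE// lerDl ltW.
have sbw : - (2 * M ^+ 2) <= symp b w.
  have bw : `|b.1 * w.2| <= M ^+ 2 by rewrite normrM expr2 ler_pM.
  have wb : `|b.2 * w.1| <= M ^+ 2 by rewrite normrM expr2 ler_pM.
  by move: bw wb; rewrite /symp !ler_norml => /andP[? ?] /andP[? ?]; lra.
(* The loss (1 - (1 - t)^2) [ceiling b] is at most 2 t M, and the symplectic term costs at most t
   M^2. *)
apply: (@le_trans _ _ (t * (2 * M + M ^+ 2))).
  have /andP[t0 t1] := t01.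
  have fbM : ceiling b <= M := le_trans (ler_norm _) fb.
  have h1 : 0 <= t ^+ 2 * ceiling b by rewrite mulr_ge0 ?sqr_ge0.
  have h2 : 0 <= t * (M - ceiling b) by rewrite mulr_ge0 ?subr_ge0.
  have h3 : 0 <= (1 - t) * t * (symp b w + 2 * M ^+ 2).
    by apply: mulr_ge0; [rewrite mulr_ge0 ?subr_ge0|rewrite -lerBlDr sub0r].
  have h4 : 0 <= t ^+ 2 * M ^+ 2 by rewrite mulr_ge0 ?sqr_ge0.
  lra.
rewrite mulrC -mulrA [r^-1 * d]mulrC ler_wpM2l//.
by rewrite addr_ge0 ?sqr_ge0// mulr_ge0// ltW.
Qed.

(* [locally [lipschitz _ | _]] quantifies over neighborhoods of all pairs (a, b)
   of interior points, including a <> b. *)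
Lemma ceiling_locally_lipschitz :
  [locally [lipschitz (ceiling v : R^o) | v in K°]].
Proof.
have [C C0 CK] := ceiling_lipschitz.
have iK (a : horiz R) : K° a -> exists2 r : R, 0 < r & forall b, `|b - a| < r ->
    forall w, `|w - b| <= r -> K w.
  move=> /nbhs_normP[e /= e0 eK]; exists (e / 2) => [|b ba w wb].
    by rewrite divr_gt0.
  apply: eK => /=; rewrite distrC -(subrK b w) -addrA.
  by rewrite (le_lt_trans (ler_normD _ _))// (splitr e) ler_ltD.
move=> [a b] [/= /iK[r r0 Ka] /iK[s s0 Kb]].
(* For x near a and y near b, the balls of radius m around x and y both lie in K, so C / m serves as
   a Lipschitz constant however far a is from b. *)
pose m := Num.min r s; have m0 : 0 < m by rewrite lt_min r0.
have le_dist (u w : horiz R) : (forall u', `|u' - u| <= m -> K u') -> K w ->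
    ceiling w - ceiling u <= C / m * `|u - w|.
  by move=> mu Kw; rewrite distrC; exact: CK.
rewrite /lipschitz_on; near=> L.
have CL : C / m <= L by near: L; apply: nbhs_pinfty_ge; exact: num_real.
apply/(nbhs_normP ((a, b) : horiz R * horiz R)); exists m => //= -[x y] /=.
rewrite prod_normE gt_max /= => /andP[ax yb] [Kx Ky].
have mr : m <= r by rewrite ge_min lexx.
have ms : m <= s by rewrite ge_min lexx orbT.
apply: (@le_trans _ _ (C / m * `|x - y|)); last by rewrite ler_wpM2r.
(* Each one-sided estimate uses the ball around the point whose ceiling is subtracted: x first, then
   y. *)
rewrite /self_sub /= ler_norml; apply/andP; split.
  rewrite lerNl opprB; apply: le_dist (interior_subset Ky) => w wx.
  by apply: (Ka x); [rewrite distrC (lt_le_trans ax)|exact: le_trans mr].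
rewrite distrC; apply: le_dist (interior_subset Kx) => w wy.
by apply: (Kb y); [rewrite distrC (lt_le_trans yb)|exact: le_trans ms].
Unshelve. all: by end_near. Qed.

End HomogeneousNorm.

Theorem proposition6p2 (R : realType) (N : heis R -> R)
    (hN : homogeneous_norm N) :
  let B : set (heis R) := [set p | N p <= 1] in
  let K : set (horiz R) := @hproj R @` B in
  [/\ compact K,
      convex_set (K : set (convex_lmodType (horiz R))),
      K = [set - v | v in K],
      K = closure (interior K) &
      exists f : horiz R -> R^o,
        [/\ forall v, v \in K -> 0 <= f v,
            [locally [lipschitz f v | v in interior K]] &
            B = [set p : heis R | p.1 \in K /\ - f (- p.1) <= p.2 <= f p.1]]].
Proof.
split.
- exact: shadow_compact.
- move=> v w t; rewrite !inE => Kv Kw.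
  (* [convex_set] gives weight t to v while [shadow_comb] gives it 1 - t, hence the parameter 1 -
     t. *)
  have t01 : 0 <= 1 - t%:num <= 1.
    rewrite subr_ge0 gerBl. by apply/andP.
  have := shadow_comb hN t01 Kv Kw.
  by rewrite subKr.
- apply/seteqP; split=> [v Kv|_ [v Kv <-]]; last exact: shadow_opp.
  by exists (- v); rewrite ?opprK//; exact: shadow_opp.
- exact: shadow_closure_interior.
(* Off K the fiber is empty and [ceiling] takes the default value 0 of [sup]. *)
exists (@ceiling R N); split.
- by move=> v; rewrite inE; exact: ceiling_ge0.
- exact: ceiling_locally_lipschitz.
- apply/seteqP; split=> p /=; rewrite in_setE; last by move=> /(ball_fiberE hN).
  by move=> Bp; exact/(ball_fiberE hN).
Qed.
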